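(* Let $p$ be an odd prime, let $\mathbb{F}_p$ be the finite field with $p$ elements, and let $K_{p+1}$ be the complete graph on the vertex set $\mathbb{F}_p \cup \{c\}$, where $c$ is an extra point (the centre). Regard $0$ as a quadratic residue and $c$ as a quadratic non-residue. For $x,y\in\mathbb{F}_p$ define the length of the edge $\{x,y\}$ as $\ell(x,y)=\{x-y,\,y-x\}\subset \mathbb{F}_p^*$, and define $\ell(c,x)=\infty$ for every $x\in\mathbb{F}_p$. Then there exists a $1$-factor $F$ of $K_{p+1}$ (a set of pairwise disjoint edges covering all vertices) such that (1) each edge of $F$ joins a quadratic residue and a quadratic non-residue, and (2) the lengths of the edges in $F$ are pairwise distinct. *)

(* Defs.v *)
From mathcomp Require Import all_boot all_algebra.
Set Implicit Arguments. Unset Strict Implicit. Unset Printing Implicit Defensive.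
Import GRing.Theory.
Local Open Scope ring_scope.

(* Vertices of K_{p+1}: Some x for x in F_p, and None for the centre c. *)
Definition vtx (p : nat) := option 'F_p.

Definition is_qr (p : nat) (v : vtx p) : bool :=
  if v is Some x then [exists y : 'F_p, y * y == x] else false.

(* Length of the edge {u,v}: {x-y, y-x} for x,y in F_p, and infinity (None)
   for edges through the centre. *)
Definition ell (p : nat) (u v : vtx p) : option {set 'F_p} :=
  match u, v with
  | Some x, Some y => Some [set x - y; y - x]
  | _, _ => None
  end.

Definition one_factor (p : nat) (F : {set {set vtx p}}) : Prop :=
  (forall e, e \in F -> exists u v : vtx p, u != v /\ e = [set u; v]) /\
  (forall w : vtx p, #|[set e in F | w \in e]| = 1%N).

(* Main.v *)
(* Let m = (p - 1)/2, S the nonzero squares, N the nonsquares.  Except for p = 5,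
   the centre is joined to 0, so one needs a bijection f : S -> N for which the
   differences x - f x are distinct up to sign.
   - m odd: f x = - x.
   - m even and some q <> 1 has odd order: choose g in N such that exactly one
     of 1 - g, 1 - q g is a square.  Let A contain one of each pair {x, -x} of S
     and be stable under q; put f x = g x on A and f x = q g x off A.  Lengths
     on A and off A have opposite quadratic characters.
   - p = 2^k + 1: use f x = h x off A and multipliers u or r u on A, where
     multiplication by r and by (1 - r u) / (1 - u) preserves the choice between
     u and r u.  Then f = h tau on A, and A must be stable under tau.  For
     u = 3/2, h = 4/3, r = 2 this can be arranged when k >= 10, since 2 has the
     small order 2k; other constants serve p = 17 and p = 257. *)
Require Import Defs.
From mathcomp Require Import all_boot all_algebra all_solvable all_field.
From mathcomp Require Import zify ring.
Set Implicit Arguments. Unset Strict Implicit. Unset Printing Implicit Defensive.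
Import GRing.Theory.
Local Open Scope ring_scope.

(** * Quadratic residues of a finite field of odd order, via Euler's criterion *)

Section Residues.
Variables (F : finFieldType) (m : nat).
Hypothesis cardF : #|F| = (2 * m).+1.

Lemma half_card_gt0 : (0 < m)%N.
Proof. by have := finNzRing_gt1 F; rewrite cardF; case: (m). Qed.

Lemma unity_neq0 n (x : F) : (0 < n)%N -> x ^+ n = 1 -> x != 0.
Proof.
by move=> n0 hx; apply/eqP=> x0; move/eqP: hx; rewrite x0 expr0n gtn_eqF // eq_sym oner_eq0.
Qed.

Lemma expf_2m (x : F) : x != 0 -> x ^+ (2 * m) = 1.
Proof.
move=> x0; have := expf_card x; rewrite cardF exprS => h.
by apply: (mulfI x0); rewrite h mulr1.
Qed.

Lemma euler_dichotomy (x : F) : x != 0 -> x ^+ m = 1 \/ x ^+ m = -1.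
Proof.
move=> /expf_2m; rewrite mulnC exprM => /eqP; rewrite sqrf_eq1.
by case/orP=> /eqP; [left|right].
Qed.

(** The nonzero elements are 2m distinct roots of X^(2m) - 1, which forces one of them to have order
    exactly 2m. *)
Lemma has_generator : exists g : F, (2 * m).-primitive_root g.
Proof.
have /hasP[g _ hg] : has (2 * m).-primitive_root [seq x <- enum F | x != 0].
  apply: has_prim_root; first by rewrite muln_gt0 half_card_gt0.
  - apply/allP=> x; rewrite mem_filter => /andP[x0 _].
    by apply/unity_rootP; exact: expf_2m.
  - by rewrite filter_uniq ?enum_uniq.
  - have := cardC1 (0 : F); rewrite cardF /= => <-.
    by rewrite cardE enumT; apply: eq_leq; rewrite /enum_mem -enumT.
by exists g.
Qed.

Lemma euler_square (x : F) : x ^+ m = 1 -> exists y, y * y = x.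
Proof.
move=> hx; have [g hg] := has_generator.
have x2m : x ^+ (2 * m) = 1 by rewrite mulnC exprM hx expr1n.
have [i xi] := prim_rootP hg x2m.
have : g ^+ (i * m) = 1 by rewrite exprM -xi.
move/eqP; rewrite -(prim_order_dvd hg) dvdn_pmul2r ?half_card_gt0 // => /dvdnP[a ia].
by exists (g ^+ a); rewrite -exprD xi ia muln2 addnn.
Qed.

Lemma oppr1_neq1 : (-1 : F) != 1.
Proof.
have [g hg] := has_generator; have m0 := half_card_gt0.
have gm : g ^+ m != 1.
  by rewrite -(prim_order_dvd hg); apply/negP=> /dvdn_leq; lia.
have g0 : g != 0 by apply: (unity_neq0 _ (prim_expr_order hg)); lia.
by case: (euler_dichotomy g0) => h; rewrite h ?eqxx // in gm.
Qed.

Lemma has_nonresidue : exists g : F, g ^+ m = -1.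
Proof.
have [g hg] := has_generator; have m0 := half_card_gt0; exists g.
have g0 : g != 0 by apply: (unity_neq0 _ (prim_expr_order hg)); lia.
case: (euler_dichotomy g0) => // /eqP.
by rewrite -(prim_order_dvd hg) => /dvdn_leq; lia.
Qed.

Lemma oppr_fixed (x : F) : (- x == x) = (x == 0).
Proof.
apply/idP/idP=> [|/eqP->]; last by rewrite oppr0.
rewrite -mulN1r -{2}[x]mul1r -subr_eq0 -mulrBl mulf_eq0 subr_eq0.
by rewrite (negPf oppr1_neq1).
Qed.

Lemma nonresidue_neq0 (g : F) : g ^+ m = -1 -> g != 0.
Proof.
move=> gm; apply/eqP=> g0; move/eqP: gm.
by rewrite g0 expr0n gtn_eqF ?half_card_gt0 // eq_sym oppr_eq0 oner_eq0.
Qed.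

(** * Choice of one element from each pair {x, -x}, and rainbow maps *)

Definition chosen (x : F) : bool := (enum_rank x < enum_rank (- x))%N.

Lemma chosenN (x : F) : x != 0 -> chosen (- x) = ~~ chosen x.
Proof.
move=> x0; rewrite /chosen opprK ltn_neqAle leqNgt.
by rewrite (inj_eq val_inj) (inj_eq enum_rank_inj) oppr_fixed x0.
Qed.

Lemma mulf_sqr_eq (a x y : F) : a != 0 -> (a * x) ^+ 2 = (a * y) ^+ 2 ->
  x = y \/ x = - y.
Proof.
move=> a0 /eqP; rewrite eqf_sqr -mulrN !(inj_eq (mulfI a0)).
by case/orP=> /eqP; [left|right].
Qed.

(* The squares of the differences x - f x encode the lengths {+-(x - f x)}. *)
Definition rainbow (f : F -> F) : Prop :=
  [/\ forall x, x ^+ m = 1 -> f x ^+ m = -1,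
      forall x y, x ^+ m = 1 -> y ^+ m = 1 -> f x = f y -> x = y
    & forall x y, x ^+ m = 1 -> y ^+ m = 1 ->
        (x - f x) ^+ 2 = (y - f y) ^+ 2 -> x = y].

(** For odd [m], -1 is a nonresidue. Equal lengths give x = y or x = -y, and two residues cannot
    satisfy the latter. *)
Lemma rainbow_opp : odd m -> rainbow -%R.
Proof.
move=> om; split=> [x hx|x y _ _ /oppr_inj //|x y hx hy].
  by rewrite exprNn hx -signr_odd om expr1 mulr1.
have two_neq0 : (2 : F) != 0.
  by rewrite -[2]/(1 + 1 : F) addr_eq0 eq_sym oppr1_neq1.
have dbl (z : F) : z - - z = 2 * z by ring.
rewrite !dbl => /(mulf_sqr_eq two_neq0)[//|xy].
move/eqP: hx; rewrite xy exprNn hy -signr_odd om expr1 mulr1.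
by rewrite (negPf oppr1_neq1).
Qed.

(** * Constructions for even [m], where -1 is a square *)

Hypothesis even_m : ~~ odd m.

Lemma expN_half (x : F) : (- x) ^+ m = x ^+ m.
Proof. by rewrite exprNn -signr_odd (negPf even_m) mul1r. Qed.

(** The quadratic character of a difference depends only on its length, so differences of opposite
    characters have distinct lengths. *)
Lemma sqr_eq_exp (x y : F) : x ^+ 2 = y ^+ 2 -> x ^+ m = y ^+ m.
Proof. by move/eqP; rewrite eqf_sqr => /orP[] /eqP->; rewrite ?expN_half. Qed.

Lemma nonresidue_neq1 (g : F) : g ^+ m = -1 -> 1 - g != 0.
Proof.
move=> hg; rewrite subr_eq0; apply/eqP=> g1; move: hg oppr1_neq1.
by rewrite -g1 expr1n => <-; rewrite eqxx.
Qed.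

(* The Moebius map g |-> (1 - g) / (1 - q g) takes the value 1 only at 0, so it
   cannot map the nonresidues bijectively onto the nonzero squares. *)
Lemma exists_split_ratio (q : F) : q != 1 -> q ^+ m = 1 ->
  exists2 g : F, g ^+ m = -1 & (1 - g) ^+ m = - (1 - q * g) ^+ m.
Proof.
move=> q1 qm; have m0 := half_card_gt0.
have [g /andP[/eqP h1 /eqP h2]|hno] :=
  pickP (fun g : F => (g ^+ m == -1) && ((1 - g) ^+ m == - (1 - q * g) ^+ m)).
  by exists g.
have q0 := unity_neq0 m0 qm; exfalso.
pose S := [set x : F | x ^+ m == 1]; pose N := [set x : F | x ^+ m == -1].
pose rho (g : F) := (1 - g) / (1 - q * g).
have qN g : g \in N -> q * g \in N by rewrite !inE exprMn qm mul1r.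
have nz g : g \in N -> 1 - g != 0 by rewrite inE => /eqP; exact: nonresidue_neq1.
have rho_inj : {in N &, injective rho}.
  move=> g h hg hh /eqP.
  rewrite /rho eqr_div ?nz ?qN // -subr_eq0.
  have -> : (1 - g) * (1 - q * h) - (1 - h) * (1 - q * g) = (1 - q) * (h - g)
    by ring.
  by rewrite mulf_eq0 !subr_eq0 eq_sym (negPf q1) /= => /eqP.
have sub : rho @: N \subset S :\ 1.
  apply/subsetP=> _ /imsetP[g hg ->]; rewrite !inE.
  have ng := nz _ hg; have nqg := nz _ (qN _ hg).
  apply/andP; split.
    apply/negP=> /eqP h; move/(congr1 (fun z => z * (1 - q * g))): h.
    rewrite /rho divfK // mul1r => /addrI /oppr_inj /eqP.
    rewrite -{1}[g]mul1r -subr_eq0 -mulrBl mulf_eq0 subr_eq0 eq_sym (negPf q1) /=.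
    by move/eqP=> g0; move: hg; rewrite g0 inE expr0n gtn_eqF // eq_sym oppr_eq0 oner_eq0.
  have := hno g; rewrite inE in hg; rewrite hg /= /rho expr_div_n.
  case: (euler_dichotomy ng) => ->; case: (euler_dichotomy nqg) => -> ;
    by rewrite ?eqxx ?opprK ?eqxx ?divff ?oppr_eq0 ?oner_eq0 // ?eqxx.
have [n hn] := has_nonresidue.
have n0 := nonresidue_neq0 hn.
(* Multiplication by a nonresidue embeds [S] into [N], so |S| <= |N| = |rho(N)| <= |S| - 1, a
   contradiction. *)
have cSN : (#|S| <= #|N|)%N.
  rewrite -(card_imset _ (mulfI n0)); apply/subset_leq_card/subsetP.
  by move=> _ /imsetP[x hx ->]; move: hx; rewrite !inE exprMn hn mulN1r eqr_opp.
have := leq_trans cSN; rewrite -(card_in_imset rho_inj).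
move/(_ _ (subset_leq_card sub)).
by rewrite (cardsD1 1 S) inE expr1n eqxx ltnn.
Qed.

(** As [t] is odd, x^t changes sign with x, and q^t = 1 makes it invariant under multiplication by
    [q]; applying [chosen] to x^t yields the required set [A]. *)
Lemma rainbow_odd_order (q : F) t : q != 1 -> odd t -> q ^+ t = 1 ->
  exists f, rainbow f.
Proof.
move=> q1 ot qt; have m0 := half_card_gt0.
have q0 : q != 0 by apply: (unity_neq0 _ qt); case: (t) ot.
have qm : q ^+ m = 1.
  case: (euler_dichotomy q0) => // h.
  have : (q ^+ m) ^+ t = 1 by rewrite -exprM mulnC exprM qt expr1n.
  by rewrite h -signr_odd ot expr1 => /eqP; rewrite (negPf oppr1_neq1).
have [g gm split_g] := exists_split_ratio q1 qm.
have qgm : (q * g) ^+ m = -1 by rewrite exprMn qm mul1r.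
have nz := nonresidue_neq0 gm.
have nqg : q * g != 0 by rewrite mulf_neq0.
have n1 := nonresidue_neq1 gm; have n2 := nonresidue_neq1 qgm.
pose A x := chosen (x ^+ t).
have AN x : x ^+ m = 1 -> A (- x) = ~~ A x.
  move=> hx; rewrite /A exprNn -signr_odd ot expr1 mulN1r chosenN //.
  by rewrite expf_neq0 // (unity_neq0 m0 hx).
have Aq x : A (q * x) = A x by rewrite /A exprMn qt mul1r.
pose f x := (if A x then g else q * g) * x.
have lenE x : x - f x = (1 - (if A x then g else q * g)) * x
  by rewrite /f mulrBl mul1r.
have absurd1 : (1 : F) <> -1 by move/eqP; rewrite eq_sym (negPf oppr1_neq1).
have absurd2 x y : x ^+ m = 1 -> y ^+ m = 1 ->
  ((1 - g) * x) ^+ 2 <> ((1 - q * g) * y) ^+ 2.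
  move=> hx hy /sqr_eq_exp; rewrite !exprMn hx hy !mulr1 split_g.
  by move/eqP; rewrite oppr_fixed expf_eq0 (negPf n2) andbF.
exists f; split=> [x hx|x y hx hy|x y hx hy].
- by rewrite /f exprMn hx mulr1; case: ifP.
- rewrite /f; case: ifPn => Ax; case: ifPn => Ay.
  + exact: mulfI.
  + rewrite [q * g]mulrC -mulrA => /(mulfI nz) xy.
    by rewrite xy Aq (negPf Ay) in Ax.
  + rewrite [q * g]mulrC -mulrA => /(mulfI nz) xy.
    by rewrite -xy Aq (negPf Ax) in Ay.
  + exact: mulfI.
- rewrite !lenE; case: ifPn => Ax; case: ifPn => Ay.
  + case/(mulf_sqr_eq n1) => // xy.
    by rewrite xy AN // Ay in Ax.
  + by move/absurd2; case.
  + by move/esym/absurd2; case.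
  + case/(mulf_sqr_eq n2) => // xy.
    by rewrite xy AN // negbK (negPf Ay) in Ax.
Qed.

(* With q = u / h, the level l x of x is its discrete logarithm to base q, read
   modulo M, i.e. modulo the subgroup of order kap.  The map tau multiplies by
   r q at the levels below j and by q at the others, so tau raises the level by
   1 and, by the closing condition, tau ^ M = id.  Hence dividing x by its level
   representative z (l x) gives a tau-invariant odd function Phi, and A := {x |
   chosen (Phi x)} is a tau-stable set containing one of each pair {x, -x}. *)
Lemma rainbow_spiral (kap M j : nat) (u h r s : F) :
    m = (kap * M)%N -> ~~ odd kap -> (j <= M)%N ->
    u ^+ m = -1 -> h ^+ m = -1 -> (1 - u) ^+ m = - (1 - h) ^+ m ->
    r ^+ kap = 1 -> s ^+ kap = 1 -> 1 - r * u = s * (1 - u) ->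
    M.-primitive_root ((u / h) ^+ kap) -> (u / h) ^+ M * r ^+ j = 1 ->
  exists f, rainbow f.
Proof.
move=> mE ek jM um hm split_uh rk sk ru prim_w closing.
have m0 := half_card_gt0; have k0 : (0 < kap)%N by move: m0; rewrite mE; case: (kap).
have M0 : (0 < M)%N by move: m0; rewrite mE muln_gt0 => /andP[].
have u0 := nonresidue_neq0 um; have h0 := nonresidue_neq0 hm.
have r0 := unity_neq0 k0 rk.
have nu := nonresidue_neq1 um; have nh := nonresidue_neq1 hm.
set q := u / h in prim_w closing.
have q0 : q != 0 by rewrite mulf_neq0 ?invr_eq0.
have uE : u = h * q by rewrite /q mulrCA divff // mulr1.
have qm : q ^+ m = 1 by rewrite expr_div_n um hm divff // oppr_eq0 oner_eq0.
clearbody q.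
set w := q ^+ kap in prim_w.
pose l (x : F) := index (x ^+ kap) [seq w ^+ i | i <- iota 0 M].
have lP x : x ^+ m = 1 -> (l x < M)%N /\ w ^+ l x = x ^+ kap.
  move=> hx; have : x ^+ kap \in [seq w ^+ i | i <- iota 0 M].
    have [|i ->] := prim_rootP prim_w (x := x ^+ kap); first by rewrite -exprM -mE.
    by apply: map_f; rewrite mem_iota /=.
  move=> xin; have lt : (l x < M)%N by move: xin; rewrite -index_mem size_map size_iota.
  split=> //; have := nth_index 0 xin; rewrite (nth_map 0%N) ?size_iota //.
  by rewrite nth_iota.
have l_eq x a : (a < M)%N -> x ^+ m = 1 -> w ^+ a = x ^+ kap -> l x = a.
  move=> aM /lP[lx <-] /eqP; rewrite (eq_prim_root_expr prim_w) !modn_small //.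
  by move/eqP.
have l_kap x y : x ^+ kap = y ^+ kap -> l x = l y by rewrite /l => ->.
(* For a <= M, [z a] is reached from 1 by [a] applications of [tau], the first [j] of which include
   the factor [r]. The closing condition says that z M = 1 = z 0. *)
pose z a := q ^+ a * r ^+ minn a j.
have z0 a : z a != 0 by rewrite mulf_neq0 // expf_neq0.
have zS a : z a.+1 = (if (a < j)%N then r else 1) * q * z a.
  rewrite /z exprS; case: ltnP => aj.
    by rewrite (minn_idPl aj) exprS; ring.
  by rewrite (minn_idPr (leqW aj)); ring.
have zM : z M = 1 by rewrite /z (minn_idPr jM).
pose c x := if (l x < j)%N then r else 1.
(* This is the factor for which 1 - c x * u = (1 - u) * d x, so lengths on [A] are those of (1 - u)
   * (d x * x). *)
pose d x := if (l x < j)%N then s else 1.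
have ck x : c x ^+ kap = 1 by rewrite /c; case: ifP; rewrite ?expr1n.
have dk x : d x ^+ kap = 1 by rewrite /d; case: ifP; rewrite ?expr1n.
have cm x : c x ^+ m = 1 by rewrite mE exprM ck expr1n.
have dm x : d x ^+ m = 1 by rewrite mE exprM dk expr1n.
have c0 x : c x != 0 := unity_neq0 k0 (ck x).
have d0 x : d x != 0 := unity_neq0 k0 (dk x).
pose tau x := c x * q * x.
have tau_m x : x ^+ m = 1 -> tau x ^+ m = 1.
  by move=> hx; rewrite !exprMn cm qm hx !mulr1.
have kN (x : F) : (- x) ^+ kap = x ^+ kap.
  by rewrite exprNn -signr_odd (negPf ek) mul1r.
pose Phi x := x / z (l x).
have Phi_tau x : x ^+ m = 1 -> Phi (tau x) = Phi x.
  move=> hx; have [lx lw] := lP x hx.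
  have tk : tau x ^+ kap = w ^+ (l x).+1.
    by rewrite exprS lw !exprMn ck mul1r.
  suff -> : Phi (tau x) = tau x / z (l x).+1.
    rewrite zS /Phi /tau -/(c x) invfM mulrA [_ * x / _]mulrAC divff ?mul1r //.
    by rewrite mulf_neq0.
  have [lt|ge] := ltnP (l x).+1 M.
    by rewrite /Phi (l_eq _ _ lt (tau_m _ hx)).
  (* From the top level M - 1, [tau] wraps around to level 0. *)
  have lM : (l x).+1 = M by apply/eqP; rewrite eqn_leq lx ge.
  rewrite /Phi (l_eq _ 0%N M0 (tau_m _ hx)) ?lM ?zM.
    by rewrite /z min0n !expr0 mulr1.
  by rewrite tk lM (prim_expr_order prim_w) expr0.
have PhiN x : Phi (- x) = - Phi x by rewrite /Phi (l_kap _ _ (kN x)) mulNr.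
pose A x := chosen (Phi x).
have A_tau x : x ^+ m = 1 -> A (tau x) = A x by move=> hx; rewrite /A Phi_tau.
have AN x : x ^+ m = 1 -> A (- x) = ~~ A x.
  move=> hx; rewrite /A PhiN chosenN // mulf_neq0 ?invr_eq0 //.
  exact: unity_neq0 m0 hx.
pose f x := h * (if A x then tau x else x).
have lenE x : x - f x = if A x then (1 - u) * (d x * x) else (1 - h) * x.
  rewrite /f; case: ifP => _; last by rewrite mulrBl mul1r.
  have -> : x - h * tau x = (1 - c x * u) * x by rewrite uE /tau; ring.
  rewrite mulrA [_ * d x]mulrC; congr (_ * _).
  by rewrite /c /d; case: ifP; rewrite ?mul1r.
(* The factors are [kap]-th roots of unity, so [kap]-th powers show that x and y have the same
   level, hence the same factor. *)
have d_inj x y : d x * x = d y * y -> x = y.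
  move=> xy; have : (d x * x) ^+ kap = (d y * y) ^+ kap by rewrite xy.
  rewrite !exprMn !dk !mul1r => /l_kap lxy.
  by move: xy; rewrite /d lxy; apply: mulfI; exact: d0.
have tau_inj x y : tau x = tau y -> x = y.
  rewrite /tau ![c _ * q]mulrC -!mulrA => /(mulfI q0) xy.
  have : (c x * x) ^+ kap = (c y * y) ^+ kap by rewrite xy.
  rewrite !exprMn !ck !mul1r => /l_kap lxy.
  by move: xy; rewrite /c lxy; apply: mulfI; exact: c0.
have dN x : d (- x) = d x by rewrite /d (l_kap _ _ (kN x)).
have mixed x y : x ^+ m = 1 -> y ^+ m = 1 ->
    ((1 - u) * (d x * x)) ^+ 2 <> ((1 - h) * y) ^+ 2.
  move=> hx hy /sqr_eq_exp; rewrite !exprMn hx hy dm !mulr1 split_uh.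
  by move/eqP; rewrite oppr_fixed expf_eq0 (negPf nh) andbF.
exists f; split=> [x hx|x y hx hy|x y hx hy].
- by rewrite exprMn hm; case: ifP; rewrite ?tau_m ?hx ?mulr1.
- move/(mulfI h0); case: ifPn => Ax; case: ifPn => Ay //.
  + exact: tau_inj.
  + by move=> xy; rewrite -xy A_tau // Ax in Ay.
  + by move=> xy; rewrite xy A_tau // Ay in Ax.
- rewrite !lenE; case: ifPn => Ax; case: ifPn => Ay.
  + case/(mulf_sqr_eq nu); first exact: d_inj.
    rewrite -mulrN -(dN y) => /d_inj xy.
    by rewrite xy AN // Ay in Ax.
  + by move/(mixed x y hx hy).
  + by move/esym/(mixed y x hy hx).
  + case/(mulf_sqr_eq nh) => // xy.
    by rewrite xy AN // negbK (negPf Ay) in Ax.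
Qed.
End Residues.

(** * Fermat primes p = 2^k + 1 with k at least 10 *)

Section Fermat.
Variables (F : finFieldType) (m : nat).
Hypothesis cardF : #|F| = (2 * m).+1.

(** The order divides 2^(e+1); a proper divisor would divide 2^e and give -1 = 1. *)
Lemma prim_root_two_power (x : F) e : x ^+ (2 ^ e) = -1 ->
  (2 ^ e.+1).-primitive_root x.
Proof.
move=> hx; have x2 : x ^+ (2 ^ e.+1) = 1 by rewrite expnSr exprM hx sqrrN expr1n.
have [d hd] := prim_order_exists (expn_gt0 2 e.+1) x2.
move/(dvdn_pfactor _ _ (isT : prime 2)) => [i]; rewrite leq_eqVlt ltnS.
case/orP=> [/eqP<- <- //|ie dE]; exfalso.
have : (d %| 2 ^ e)%N by rewrite dE dvdn_exp2l.
by rewrite (prim_order_dvd hd) hx; apply/negP; exact: oppr1_neq1 cardF.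
Qed.
End Fermat.

Lemma rainbow_fermat p k : prime p -> p = (2 ^ k).+1 -> (10 <= k)%N ->
  exists f : 'F_p -> 'F_p, rainbow (2 ^ k.-1) f.
Proof.
move=> pp pE k10.
have pm : (2 * 2 ^ k.-1 = 2 ^ k)%N by rewrite -expnS prednK //; lia.
set m := (2 ^ k.-1)%N in pm *.
have cardF : #|'F_p| = (2 * m).+1 by rewrite card_Fp // pm.
have em : ~~ odd m by rewrite /m oddX orbF -lt0n; lia.
have nat0 n : (n%:R == 0 :> 'F_p) = (p %| n)%N by rewrite (dvdn_pcharf (pchar_Fp pp)).
have twok : (2 : 'F_p) ^+ k = -1.
  by apply/eqP; rewrite -addr_eq0 -natrX -[1]/(1%:R) -natrD nat0 addn1 -pE.
have p3 : (3 < p)%N.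
  by rewrite pE ltnS (@leq_trans (2 ^ 10)%N) // leq_exp2l.
have n2 : (2 : 'F_p) != 0 by rewrite nat0 gtnNdvd // ltnW.
have n3 : (3 : 'F_p) != 0 by rewrite nat0 gtnNdvd.
have m0 := half_card_gt0 cardF.
have [a kE prim2] : exists2 a, (2 * k = 2 ^ a)%N & (2 * k).-primitive_root (2 : 'F_p).
  have two2k : (2 : 'F_p) ^+ (2 * k) = 1 by rewrite mulnC exprM twok sqrrN expr1n.
  have [|d hd dk] := prim_order_exists _ two2k; first by lia.
  (* If d <= k, then p would divide the positive number 2^d - 1 < p. A divisor of 2k exceeding k is
     2k itself. *)
  have kd : (k < d)%N.
    rewrite ltnNge; apply/negP=> le.
    have d0 := prim_order_gt0 hd.
    have : (p %| 2 ^ d - 1)%N.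
      by rewrite -nat0 natrB ?expn_gt0 // natrX (prim_expr_order hd) subrr.
    move/dvdn_leq; rewrite subn_gt0 -{1}(expn0 2) ltn_exp2l // => /(_ d0).
    have : (2 ^ d <= 2 ^ k)%N by rewrite leq_exp2l.
    by rewrite pE; lia.
  have dE : d = (2 * k)%N.
    by case/dvdnP: dk => -[|[|e]]; nia.
  have : (d %| 2 ^ k)%N by rewrite (prim_order_dvd hd) -pm expf_2m.
  move/(dvdn_pfactor _ _ (isT : prime 2)) => [a _ dE']; exists a; rewrite -?dE //.
set kap := (2 * k)%N in kE prim2.
have a5 : (5 <= a)%N.
  rewrite ltnNge; apply/negP=> a4.
  have : (2 ^ a <= 2 ^ 4)%N by rewrite leq_exp2l.
  by rewrite -kE /kap; lia.
(* This is where the size of [k] enters: it gives kap <= M, leaving room for any [j] up to [kap]. *)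
have ak : (2 * a + 1 <= k)%N.
  have : (2 * (2 * a + 1) <= 2 ^ a)%N.
    elim: a a5 {kE} => // a IH; rewrite leq_eqVlt => /orP[/eqP <- //|].
    by move=> a5; have := IH a5; rewrite expnS; lia.
  by rewrite -kE /kap; lia.
set M := (2 ^ (k.-1 - a))%N.
have mE : m = (kap * M)%N by rewrite kE -expnD /m; congr (2 ^ _)%N; lia.
have kM : (kap <= M)%N by rewrite kE leq_exp2l //; lia.
have two_kap := prim_expr_order prim2.
have two_m : (2 : 'F_p) ^+ m = 1 by rewrite mE exprM two_kap expr1n.
(* Were 3 a square, so would be -3, and (-1 + sqrt -3) / 2 would have order 3. *)
have three_m : (3 : 'F_p) ^+ m = -1.
  case: (euler_dichotomy cardF n3) => // h3; exfalso.
  have [y y3] := euler_square cardF h3.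
  have [i i1] : exists i : 'F_p, i * i = -1.
    by apply: (euler_square cardF); rewrite expN_half // expr1n.
  pose t := i * y.
  have t2 : t * t = -3 by rewrite mulrACA i1 y3 mulN1r.
  have w3 : ((-1 + t) / 2) ^+ 3 = 1.
    rewrite expr_div_n.
    have -> : (-1 + t) ^+ 3 = -1 + 3 * t - 3 * (t * t) + t * (t * t) by ring.
    rewrite t2; have -> : -1 + 3 * t - 3 * -3 + t * -3 = 2 ^+ 3 by ring.
    by rewrite divff // expf_neq0.
  (* The order of (-1 + t) / 2 divides both 3 and 2^k, so this element is 1. Then t^2 = -3 becomes
     12 = 0. *)
  have : t = 3.
    have [//|d hd d3] := prim_order_exists _ w3.
    have d2k : (d %| 2 ^ k)%N.
      rewrite (prim_order_dvd hd) -pm expf_2m //.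
      exact: unity_neq0 (isT : 0 < 3)%N w3.
    have d1 : (d %| 1)%N.
      by rewrite -(eqP (_ : coprime 3 (2 ^ k))) ?dvdn_gcd ?d3 // coprimeXr.
    have := prim_expr_order hd; move: d1; rewrite dvdn1 => /eqP ->.
    rewrite expr1 => /(congr1 (fun z => z * 2 + 1)).
    by rewrite divfK // mul1r addrAC addNr add0r => ->; ring.
  move=> t3; move/eqP: t2; rewrite t3 -subr_eq0.
  have -> : 3 * 3 - - 3 = 2 * 2 * 3 :> 'F_p by ring.
  by rewrite !mulf_eq0 (negPf n2) (negPf n3).
pose q : 'F_p := (3 / 2) / (4 / 3).
have four : (4 : 'F_p) = 2 * 2 by ring.
have n4 : (4 : 'F_p) != 0 by rewrite four mulf_neq0.
have four_m : (4 : 'F_p) ^+ m = 1 by rewrite four exprMn two_m mulr1.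
have n8 : (8 : 'F_p) != 0 by have -> : (8 : 'F_p) = 2 * 4 by [ring]; rewrite mulf_neq0.
have qE : q = 3 ^+ 2 / 2 ^+ 3 by rewrite /q; field; rewrite n2 n3 n4 n8.
(* With q = 9/8 this is 3^m / 2^(3m/2), and the order 2k of 2 divides m/2. *)
have q_half : q ^+ (2 ^ (k - 2)) = -1.
  have m2 : m = (2 * 2 ^ (k - 2))%N by rewrite -expnS /m; congr (2 ^ _)%N; lia.
  rewrite qE expr_div_n -!exprM -m2 three_m mulnC exprM.
  have -> : (2 ^ (k - 2) = kap * 2 ^ (k - 2 - a))%N.
    by rewrite kE -expnD; congr (2 ^ _)%N; lia.
  by rewrite [_ ^+ (kap * _)]exprM two_kap !expr1n divr1.
have prim_q : m.-primitive_root q.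
  have := prim_root_two_power cardF q_half.
  by have -> : ((k - 2).+1 = k.-1)%N by lia.
have prim_w : M.-primitive_root (q ^+ kap).
  have := exp_prim_root prim_q kap; rewrite mE gcdnMr mulKn //.
  by rewrite kE expn_gt0.
(* As a [kap]-th root of unity, q^M is a power 2^i; taking j = kap - i closes the spiral. *)
have [i qM] : {i : 'I_kap | q ^+ M = 2 ^+ i}.
  by apply: (prim_rootP prim2); rewrite -exprM mulnC -mE (prim_expr_order prim_q).
have n2V : (2 : 'F_p)^-1 ^+ m = 1 by rewrite exprVn two_m invr1.
(* Here 1 - u = -1/2 is a residue and 1 - h = -1/3 a nonresidue, while 1 - 2u = -2 = 4 (1 - u) gives
   s = 4. *)
apply: (rainbow_spiral (kap := kap) (M := M) (j := (kap - i)%N)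
          (u := 3 / 2) (h := 4 / 3) (r := 2) (s := 4) cardF em mE) => //.
- by rewrite kE oddX orbF -lt0n (leq_trans _ a5).
- by apply: leq_trans kM; rewrite leq_subr.
- by rewrite expr_div_n three_m two_m divr1.
- by rewrite expr_div_n three_m four_m invrN1 mul1r.
- have -> : 1 - 3 / 2 = - (2^-1) :> 'F_p by field.
  have -> : 1 - 4 / 3 = - (3^-1) :> 'F_p by field.
  by rewrite !expN_half // n2V exprVn three_m invrN1 opprK.
- by rewrite four exprMn two_kap mulr1.
- by field.
- by rewrite -/q qM -exprD subnKC ?two_kap // ltnW.
Qed.

(** * From rainbow maps to one-factors *)

Section Matching.
Variable p : nat.

(** The edges are {x, phi x} for residues x, 0 included; surjectivity onto the nonresidues will
    follow by counting. *)
Definition rainbow_matching (phi : 'F_p -> vtx p) : Prop :=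
  [/\ forall x, is_qr (Some x : vtx p) -> ~~ is_qr (phi x),
      forall x y, is_qr (Some x : vtx p) -> is_qr (Some y : vtx p) ->
        phi x = phi y -> x = y
    & forall x y, is_qr (Some x : vtx p) -> is_qr (Some y : vtx p) ->
        ell (Some x) (phi x) = ell (Some y) (phi y) -> x = y].

Lemma ellC (u v : vtx p) : ell u v = ell v u.
Proof. by case: u v => [x|] [y|] //=; rewrite setUC. Qed.

Lemma ell_set2 (u v a b : vtx p) : [set u; v] = [set a; b] -> ell u v = ell a b.
Proof.
move=> e.
have /set2P hu : u \in [set a; b] by rewrite -e set21.
have /set2P hv : v \in [set a; b] by rewrite -e set22.
have /set2P ha : a \in [set u; v] by rewrite e set21.
have /set2P hb : b \in [set u; v] by rewrite e set22.
case: hu hv ha hb => uE [] vE [] aE [] bE;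
  by [congruence | rewrite ellC; congruence].
Qed.

Hypothesis pp : prime p.
Variable m : nat.
Hypothesis pE : p = (2 * m).+1.

Let cardF : #|'F_p| = (2 * m).+1.
Proof. by rewrite card_Fp. Qed.

Lemma is_qrE (x : 'F_p) : is_qr (Some x : vtx p) = (x == 0) || (x ^+ m == 1).
Proof.
apply/existsP/orP=> [[y /eqP <-]|[/eqP->|/eqP/(euler_square cardF)[y yx]]].
- have [->|y0] := eqVneq y 0; first by left; rewrite mul0r.
  by right; rewrite -expr2 -exprM (expf_2m cardF).
- by exists 0; rewrite mul0r.
- by exists y; rewrite yx.
Qed.

(** For a nonresidue g, sending 0 to the centre and x to g x covers all nonresidues. *)
Lemma card_nonresidue_vtx :
  (#|[set v : vtx p | ~~ is_qr v]| <= #|[set x : 'F_p | is_qr (Some x : vtx p)]|)%N.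
Proof.
have m0 := half_card_gt0 cardF; have [g gm] := has_nonresidue cardF.
have g0 : g != 0 by apply: (nonresidue_neq0 cardF).
pose to_nr (x : 'F_p) : vtx p := if x == 0 then None else Some (g * x).
apply: leq_trans (leq_imset_card to_nr _); apply/subset_leq_card/subsetP=> v.
rewrite inE; case: v => [x|_]; last first.
  by apply/imsetP; exists 0; rewrite /to_nr ?inE ?is_qrE eqxx.
rewrite is_qrE negb_or => /andP[x0 xm].
apply/imsetP; exists (g^-1 * x); last first.
  by rewrite /to_nr mulf_eq0 invr_eq0 (negPf g0) (negPf x0) mulVKf.
rewrite inE is_qrE; apply/orP; right; rewrite exprMn exprVn gm.
by case: (euler_dichotomy cardF x0) xm => ->; rewrite ?eqxx // invrN1 mulrNN mulr1.
Qed.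

(** Only the edge at 0 has infinite length, and equal finite lengths mean differences equal up to
    sign, hence equal squares. *)
Lemma matching_of_rainbow (f : 'F_p -> 'F_p) : rainbow m f ->
  rainbow_matching (fun x => if x == 0 then None else Some (f x)).
Proof.
case=> nr inj len; have m0 := half_card_gt0 cardF.
have qr x : is_qr (Some x : vtx p) -> x != 0 -> x ^+ m = 1.
  by rewrite is_qrE => /orP[->//|/eqP].
split=> [x /qr hx|x y /qr hx /qr hy|x y /qr hx /qr hy].
- case: eqP hx => // _ /(_ isT) /nr hx; rewrite is_qrE hx negb_or.
  by rewrite (nonresidue_neq0 cardF hx) (oppr1_neq1 cardF).
- case: eqVneq hx => [->|_] hx; case: eqVneq hy => [->|_] hy // -[].
  by apply: inj; [exact: hx|exact: hy].
- case: eqVneq hx => [->|_] hx; case: eqVneq hy => [->|_] hy //=.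
  case=> /setP/(_ (x - f x)); rewrite set21 => /esym/set2P xy.
  apply: len; [exact: hx|exact: hy|].
  by case: xy => ->; rewrite // -opprB sqrrN.
Qed.

(** Each edge has one residue, its index x, and one nonresidue, [phi x]. Bijectivity of [phi] from
    residues to nonresidues then puts every vertex in exactly one edge. *)
Lemma one_factor_of_matching : (exists phi, rainbow_matching phi) ->
  exists F : {set {set vtx p}},
    one_factor F /\
    (forall e, e \in F ->
       exists u v : vtx p, e = [set u; v] /\ is_qr u /\ ~~ is_qr v) /\
    (forall u1 v1 u2 v2 : vtx p,
       [set u1; v1] \in F -> [set u2; v2] \in F ->
       ell u1 v1 = ell u2 v2 -> [set u1; v1] = [set u2; v2]).
Proof.
case=> phi [nq inj len].
pose A := [set x : 'F_p | is_qr (Some x : vtx p)].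
pose E x : {set vtx p} := [set Some x; phi x].
have qE x v : x \in A -> is_qr v -> v \in E x -> v = Some x.
  by rewrite inE => /nq hx hv; rewrite !inE => /orP[/eqP //|/eqP h]; rewrite h (negPf hx) in hv.
have nE x v : x \in A -> ~~ is_qr v -> v \in E x -> v = phi x.
  by rewrite inE => hx hv; rewrite !inE => /orP[/eqP h|/eqP //]; rewrite h hx in hv.
have onto v : ~~ is_qr v -> exists2 x, x \in A & v = phi x.
  move=> hv; have : phi @: A == [set v : vtx p | ~~ is_qr v].
    rewrite eqEcard; apply/andP; split.
      by apply/subsetP=> _ /imsetP[x hx ->]; rewrite inE nq //; rewrite inE in hx.
    rewrite card_in_imset ?card_nonresidue_vtx // => x y.
    by rewrite !inE; exact: inj.
  move/eqP/setP/(_ v); rewrite inE hv => /imsetP[x hx ->].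
  by exists x.
exists (E @: A); split; first split.
- move=> _ /imsetP[x hx ->]; exists (Some x), (phi x); split=> //.
  by rewrite inE in hx; apply/eqP=> h; move: (nq x hx); rewrite -h hx.
- move=> w; have [hw|hw] := boolP (is_qr w).
    case: w hw => [x hx|//]; apply/eqP/cards1P; exists (E x).
    apply/setP=> e; rewrite !inE; apply/andP/eqP=> [[/imsetP[y hy ->]]|->].
      by move/(qE _ _ hy hx) => [->].
    by rewrite set21; split=> //; apply: imset_f; rewrite inE.
  have [x hx wE] := onto w hw; apply/eqP/cards1P; exists (E x).
  apply/setP=> e; rewrite !inE; apply/andP/eqP=> [[/imsetP[y hy ->]]|->].
    move/(nE _ _ hy hw); rewrite wE => h; congr E; apply/esym.
    by rewrite !inE in hx hy; exact: inj.
  by rewrite wE set22; split=> //; apply: imset_f.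
split.
- move=> _ /imsetP[x hx ->]; exists (Some x), (phi x); rewrite inE in hx.
  by split=> //; split=> //; exact: nq.
- move=> u1 v1 u2 v2 /imsetP[x hx e1] /imsetP[y hy e2].
  rewrite e1 e2 (ell_set2 e1) (ell_set2 e2) !inE in hx hy * => h.
  by rewrite (len x y).
Qed.
End Matching.

(** * The small Fermat primes 17, 257 and 5 *)

Lemma rainbow_17 : exists f : 'F_17 -> 'F_17, rainbow 8 f.
Proof.
have cardF : #|'F_17| = (2 * 8).+1 by exact: card_Fp.
(* The numbers are [kap], [M], [j], [u], [h], [r], [s]. Here q = 5/6 = -2, so q^4 = -1 has order 2,
   and q^2 * 13 = 52 = 1. *)
apply: (@rainbow_spiral 'F_17 8 cardF _ 4 2 1 5 6 13 16).
1-4: by [].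
1-6: by apply/eqP; vm_compute.
2: by apply/eqP; vm_compute.
apply: (@prim_root_two_power 'F_17 8 cardF _ 0).
by apply/eqP; vm_compute.
Qed.

Lemma rainbow_257 : exists f : 'F_257 -> 'F_257, rainbow 128 f.
Proof.
have cardF : #|'F_257| = (2 * 128).+1 by exact: card_Fp.
apply: (@rainbow_spiral 'F_257 128 cardF _ 8 16 1 5 6 193 241).
1-4: by [].
1-6: by apply/eqP; vm_compute.
2: by apply/eqP; vm_compute.
apply: (@prim_root_two_power 'F_257 128 cardF _ 3).
by apply/eqP; vm_compute.
Qed.

(** Only k = 2, 4, 8 survive: for k <= 1 the number 2^(k.-1) is 1, hence odd, and the other
    exponents give composite numbers. *)
Lemma rainbow_small_fermat k : (k < 10)%N -> let p := (2 ^ k).+1 in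
  prime p -> ~~ odd (2 ^ k.-1) ->
  p = 5 \/ exists f : 'F_p -> 'F_p, rainbow (2 ^ k.-1) f.
Proof.
move=> k10 p; have composite : prime p = false -> prime p ->
    ~~ odd (2 ^ k.-1) -> p = 5 \/ exists f : 'F_p -> 'F_p, rainbow (2 ^ k.-1) f.
  by move=> ->.
rewrite {}/p in composite *.
case: k k10 composite => [|[|[|[|[|[|[|[|[|[|k]]]]]]]]]] k10 composite.
- by [].
- by [].
- by left.
- by apply: composite; vm_compute.
- by move=> _ _; right; exact: rainbow_17.
- by apply: composite; vm_compute.
- by apply: composite; vm_compute.
- by apply: composite; vm_compute.
- by move=> _ _; right; exact: rainbow_257.
- by apply: composite; vm_compute.
- by [].
Qed.

(* For p = 5 no solution joins the centre to 0. *)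
Lemma rainbow_matching_5 : rainbow_matching
  (fun x : 'F_5 => if x == 0 then Some 2 else if x == 1 then None else Some 3).
Proof.
have qr x : is_qr (Some x : vtx 5) -> x \in [:: 0; 1; 4].
  by rewrite (@is_qrE 5 isT 2 erefl) //; case: x => [[|[|[|[|[|//]]]]] hx].
have nr x : x ^+ 2 = -1 -> ~~ is_qr (Some x : vtx 5).
  by rewrite (@is_qrE 5 isT 2 erefl) //; case: x => [[|[|[|[|[|//]]]]] hx].
split=> [x /qr|x y /qr hx /qr hy|x y /qr hx /qr hy].
- by rewrite !inE => /or3P[] /eqP->; rewrite //=; apply: nr; apply/eqP.
- by move: hx hy; rewrite !inE => /or3P[] /eqP-> /or3P[] /eqP->.
(* The lengths at 0, 1, 4 are {2, 3}, infinity and {1, 4}; the element 0 - 2 = 3 separates the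
   finite ones. *)
- move: hx hy; rewrite !inE => /or3P[] /eqP-> /or3P[] /eqP-> //=.
  + by case=> /setP/(_ (0 - 2)); rewrite !inE.
  + by case=> /setP/(_ (0 - 2)); rewrite !inE.
Qed.

Theorem theorem1p2 (p : nat) (hp : prime p) (hodd : odd p) :
  exists F : {set {set vtx p}},
    one_factor F /\
    (forall e, e \in F ->
       exists u v : vtx p, e = [set u; v] /\ is_qr u /\ ~~ is_qr v) /\
    (forall u1 v1 u2 v2 : vtx p,
       [set u1; v1] \in F -> [set u2; v2] \in F ->
       ell u1 v1 = ell u2 v2 -> [set u1; v1] = [set u2; v2]).
Proof.
pose m := p./2; have pE : p = (2 * m).+1.
  by rewrite -{1}[p]odd_double_half hodd /m add1n mul2n.
apply: (one_factor_of_matching hp pE).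
have cardF : #|'F_p| = (2 * m).+1 by rewrite card_Fp.
suff H : p = 5 \/ exists f : 'F_p -> 'F_p, rainbow m f.
  case: H => [p5|[f /(matching_of_rainbow hp pE)]]; last by eexists; eassumption.
  by rewrite p5; eexists; exact: rainbow_matching_5.
have [om|em] := boolP (odd m); first by right; exists -%R; exact: rainbow_opp.
have m0 := half_card_gt0 cardF; have p1 : (0 < 2 * m)%N by rewrite muln_gt0.
(* Write p - 1 = t 2^k with [t] odd. If t is not 1, then g^(2^k) is a nontrivial element of odd
   order for a generator g; otherwise p = 2^k + 1. *)
have [t ot mE] := pfactor_coprime (isT : prime 2) p1.
rewrite coprime2n in ot; set k := logn 2 (2 * m) in mE.
have [t1|t1] := eqVneq t 1%N; last first.
  right; have [g hg] := has_generator cardF.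
  apply: (rainbow_odd_order cardF em (q := g ^+ (2 ^ k)) _ ot).
    rewrite -(prim_order_dvd hg) mE; apply/negP=> /dvdn_leq.
    rewrite expn_gt0 /= -{2}[(2 ^ k)%N]mul1n leq_pmul2r ?expn_gt0 // => /(_ isT).
    by case: (t) ot t1 => [|[]].
  by rewrite -exprM mulnC -mE (prim_expr_order hg).
rewrite t1 mul1n in mE.
have pk : p = (2 ^ k).+1 by rewrite pE mE.
have mk : m = (2 ^ k.-1)%N.
  by case: (k) mE => [|k'] /=; rewrite ?expnS; [lia|move/eqP; rewrite eqn_pmul2l // => /eqP].
have [k10|k10] := leqP 10 k.
  by right; have := rainbow_fermat hp pk k10; rewrite -mk.
by have := rainbow_small_fermat k10; rewrite -pk -mk; apply.
Qed.
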